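(* For a discretely ordered abelian group $(G,<)$, the following are equivalent: a) $(G,<)$ is symmetrically d-complete, b) $(G,<)$ is spherically complete w.r.t. the order balls, c) $(G,<)$ is a $\mathbb{Z}$-group such that $G/\mathbb{Z}$ is strongly symmetrically complete. Further, $(G,<)$ is extremely symmetrically d-complete if and only if $G/\mathbb{Z}$ is extremely symmetrically complete.
   Context: Ordered means linearly ordered. An ordered abelian group is discretely ordered if it has a smallest positive element; the convex subgroup generated by this element is isomorphic to $\mathbb{Z}$ and is identified with $\mathbb{Z}$, and $G/\mathbb{Z}$ carries the induced ordering. $G$ is a $\mathbb{Z}$-group if it admits (an isomorphic image of) $\mathbb{Z}$ as a convex subgroup such that $G/\mathbb{Z}$ is divisible. A linearly ordered set is spherically complete w.r.t. the order balls if every nonempty chain (w.r.t. inclusion) of closed bounded intervals $[a,b]$, $a\le b$, has nonempty intersection. A cut in a linearly ordered set $I$ is a pair $(D,E)$ of nonempty subsets with $I=D\cup E$ and $d<e$ for all $d\in D$, $e\in E$. Its cofinality is $(\kappa,\lambda)$ with $\kappa=\mathrm{cf}(D)$ the cofinality of $D$ and $\lambda=\mathrm{ci}(E)$ the coinitiality of $E$ (cofinality under the reversed ordering); these equal $1$ when $D$ has a maximum, resp. $E$ has a minimum. The cut is principal if $D$ has a maximum or $E$ has a minimum; asymmetric if $\kappa\ne\lambda$; strongly asymmetric if $\kappa\ne\lambda$ and at least one of $\kappa,\lambda$ is uncountable. $I$ is strongly symmetrically complete if every cut in $I$ is strongly asymmetric, and extremely symmetrically complete if in addition both its coinitiality and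 cofinality are uncountable. An ordered abelian group $G$ is symmetrically d-complete if every nonprincipal cut in $G$ is asymmetric, and extremely symmetrically d-complete if in addition $G$ has uncountable cofinality. All these notions for ordered abelian groups refer to the underlying linearly ordered set. *)

(* Defs.v *)
From HB Require Import structures.
From mathcomp Require Import all_boot all_order all_algebra.
From mathcomp Require Import all_classical.

Set Implicit Arguments.
Unset Strict Implicit.
Unset Printing Implicit Defensive.

Import Order.TTheory GRing.Theory Num.Theory.

Local Open Scope classical_set_scope.
Local Open Scope card_scope.
Local Open Scope quotient_scope.
Local Open Scope ring_scope.

Section LinearOrders.
Context {d : Order.disp_t} {T : orderType d}.
Implicit Types (r : rel T) (D E K L : set T).

Local Open Scope order_scope.

Definition cofinal_in r D K : Prop :=
  K `<=` D /\ forall x, D x -> exists2 y, K y & r x y.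

(* cf(D) is the least cardinality of a cofinal subset of D; instead of a type
   of cardinal numbers we use subsets K whose cardinality is cf(D).  Taking
   [r := <=%O] gives the cofinality, [r := >=%O] the coinitiality. *)
Definition has_cof r D K : Prop :=
  cofinal_in r D K /\ forall K', cofinal_in r D K' -> K #<= K'.

Definition uncountable_cof r D : Prop :=
  exists2 K, has_cof r D K & ~ countable K.

Definition cut D E : Prop :=
  [/\ D !=set0, E !=set0, D `|` E = setT &
      forall x y, D x -> E y -> x < y].

Definition principal_cut D E : Prop :=
  (exists2 m, D m & forall x, D x -> x <= m) \/
  (exists2 m, E m & forall x, E x -> m <= x).

Definition asymmetric_cut D E : Prop :=
  exists K L, [/\ has_cof <=%O D K, has_cof >=%O E L & ~~ (K #= L)].

Definition strongly_asymmetric_cut D E : Prop :=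
  asymmetric_cut D E /\ (uncountable_cof <=%O D \/ uncountable_cof >=%O E).

End LinearOrders.

Section Completeness.
Context {d : Order.disp_t} (T : orderType d).

Definition spherically_complete : Prop :=
  forall F : set (set T),
    F !=set0 ->
    (forall B, F B -> exists a b : T, (a <= b)%O /\ B = `[a, b]%classic) ->
    (forall A B, F A -> F B -> A `<=` B \/ B `<=` A) ->
    \bigcap_(B in F) B !=set0.

Definition strongly_symmetrically_complete : Prop :=
  forall D E : set T, cut D E -> strongly_asymmetric_cut D E.

Definition extremely_symmetrically_complete : Prop :=
  [/\ strongly_symmetrically_complete,
      uncountable_cof (>=%O : rel T) setT &
      uncountable_cof (<=%O : rel T) setT].

Definition symmetrically_d_complete : Prop :=
  forall D E : set T, cut D E -> ~ principal_cut D E -> asymmetric_cut D E.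

Definition extremely_symmetrically_d_complete : Prop :=
  symmetrically_d_complete /\ uncountable_cof (<=%O : rel T) setT.

End Completeness.

HB.mixin Record POrderedZmodule_isOrderedAbelianGroup G
    of Num.POrderedZmodule G := {
  oag_le_total : total (<=%R : rel G);
  oag_leD2l : forall z x y : G, x <= y -> z + x <= z + y
}.

#[short(type="oagType")]
HB.structure Definition OrderedAbelianGroup :=
  { G of Num.POrderedZmodule G & POrderedZmodule_isOrderedAbelianGroup G }.

(* Order.Total is derived rather than listed as a parent because the join of
   Order.Total and GRing.Zmodule is already taken by Num.RealDomain. *)
#[non_forgetful_inheritance]
HB.instance Definition _ (G : oagType) :=
  Order.POrder_isTotal.Build ring_display (OrderedAbelianGroup.sort G)
    oag_le_total.

Lemma oag_leD2 (G : oagType) (z x y : G) : (z + x <= z + y) = (x <= y).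
Proof.
apply/idP/idP => [/(oag_leD2l (- z))|]; last exact: oag_leD2l.
by rewrite !addKr.
Qed.

Definition smallest_positive (G : oagType) (e : G) : Prop :=
  0 < e /\ forall x : G, 0 < x -> e <= x.

Definition discretely_ordered (G : oagType) : Prop :=
  exists e : G, smallest_positive e.

Record convSubgroup (G : oagType) := ConvSubgroup {
  conv_set :> G -> Prop;
  conv0 : conv_set 0;
  convB : forall x y, conv_set x -> conv_set y -> conv_set (x - y);
  conv_convex : forall x y z,
    conv_set x -> conv_set z -> x <= y <= z -> conv_set y
}.

Section Generated.
Context {G : oagType} (A : set G).

Definition conv_gen_set : set G :=
  \bigcap_(C in [set C : convSubgroup G | A `<=` conv_set C]) conv_set C.

Lemma conv_gen_set0 : conv_gen_set 0. Proof. by move=> C _; exact: conv0. Qed.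

Lemma conv_gen_setB x y :
  conv_gen_set x -> conv_gen_set y -> conv_gen_set (x - y).
Proof. by move=> gx gy C AsubC; apply: convB; [exact: gx|exact: gy]. Qed.

Lemma conv_gen_set_convex x y z :
  conv_gen_set x -> conv_gen_set z -> x <= y <= z -> conv_gen_set y.
Proof.
by move=> gx gz xyz C AsubC; apply: conv_convex xyz; [exact: gx|exact: gz].
Qed.

Definition conv_gen : convSubgroup G :=
  ConvSubgroup conv_gen_set0 conv_gen_setB conv_gen_set_convex.

End Generated.

(* The convex subgroup identified with Z when G is discretely ordered; a
   smallest positive element is unique if it exists. *)
Definition Zsub (G : oagType) : convSubgroup G :=
  conv_gen [set e : G | smallest_positive e].

Lemma ZsubP (G : oagType) (e : G) : smallest_positive e ->
  conv_set (Zsub G) = range (fun n : int => e *~ n).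
Proof.
move=> [e0 emin].
have nge0 (n : nat) : 0 <= e *+ n.
  elim: n => [|n IH] //; rewrite mulrS; apply: le_trans (ltW e0) _.
  by rewrite -{1}[e]addr0 oag_leD2.
apply/seteqP; split; last first.
  move=> _ [n _ <-] C AsubC; have Ce : C e by exact: AsubC.
  have Copp x : C x -> C (- x).
    by move=> Cx; rewrite -sub0r; apply: convB => //; exact: conv0.
  have Cn (m : nat) : C (e *+ m).
    elim: m => [|m IH]; first exact: conv0.
    by rewrite mulrS -[e *+ m]opprK; apply: convB => //; exact: Copp.
  by case: n => m; [exact: Cn|apply: Copp; exact: Cn].
have bounded (n : nat) (y : G) : 0 <= y -> y <= e *+ n ->
    range (fun n : int => e *~ n) y.
  elim: n y => [|n IH] y y0 yn.
    by exists 0 => //; rewrite mulr0z; apply: le_anti; rewrite y0.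
  have [->|yn0] := eqVneq y 0; first by exists 0.
  have {}y0 : 0 < y by rewrite lt_neqAle eq_sym yn0.
  have ey : 0 <= y - e by rewrite -(oag_leD2 e) addr0 addrC subrK emin.
  have /IH[//|m _ me] : y - e <= e *+ n.
    by rewrite -(oag_leD2 e) -mulrS addrC subrK.
  by exists (m + 1) => //; rewrite mulrzDr mulr1z me subrK.
pose R := range (fun n : int => e *~ n).
have RB x y : R x -> R y -> R (x - y).
  by move=> [m _ <-] [n _ <-]; exists (m - n) => //; rewrite mulrzBr.
have R0 : R 0 by exists 0.
have Rconv x y z : R x -> R z -> x <= y <= z -> R y.
  move=> Rx Rz /andP[xy yz].
  have [k _ ke] := RB _ _ Rz Rx.
  have yx0 : 0 <= y - x by rewrite -(oag_leD2 x) addr0 addrC subrK.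
  have yxk : y - x <= e *~ k.
    by rewrite ke -(oag_leD2 x) addrC subrK addrC subrK.
  have {}Rz : R (y - x).
    case: k {ke} yxk => m yxm; first exact: (bounded m).
    apply: (bounded 0%N) => //; apply: le_trans yxm _.
    by rewrite -(oag_leD2 (e *+ m.+1)) addrC addNr addr0; exact: nge0.
  rewrite -[y](subrK x) -[x in _ + x]opprK; apply: (RB) => //.
  by rewrite -sub0r; exact: (RB).
move=> x /(_ (ConvSubgroup R0 RB Rconv)); apply => f [f0 fmin] /=.
exists 1 => //; rewrite mulr1z; apply: le_anti.
by rewrite emin // fmin.
Qed.

Section Quotient.
Context {G : oagType} (C : convSubgroup G).

Definition conv_pred : {pred G} := fun x => `[< C x >].

Lemma conv_predP x : reflect (C x) (x \in conv_pred).
Proof. exact: asboolP. Qed.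

Lemma conv_zmod_closed : zmod_closed conv_pred.
Proof.
split=> [|x y /conv_predP Cx /conv_predP Cy]; apply/conv_predP.
  exact: conv0.
exact: convB.
Qed.

HB.instance Definition _ := GRing.isZmodClosed.Build G conv_pred
  conv_zmod_closed.

Definition oquot : Type := Quotient.quot conv_pred.

HB.instance Definition _ := GRing.Zmodule.on oquot.

Definition oquot_pi (x : G) : oquot := \pi_(Quotient.quot conv_pred) x.

Definition oquot_le : rel oquot := fun x y =>
  `[< exists a b : G, [/\ x = oquot_pi a, y = oquot_pi b & a <= b] >].

Lemma oquot_piE a b : oquot_pi a = oquot_pi b <-> C (a - b).
Proof.
rewrite /oquot_pi; split => [/eqP|Cab].
  by rewrite -Quotient.idealrBE => /conv_predP.
by apply/eqP; rewrite -Quotient.idealrBE; apply/conv_predP.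
Qed.

Lemma oquot_piD a b : oquot_pi (a + b) = oquot_pi a + oquot_pi b.
Proof. by rewrite /oquot_pi; exact: Quotient.pi_add. Qed.

Lemma oquot_pi_surj x : exists a, x = oquot_pi a.
Proof. by exists (repr x); rewrite /oquot_pi reprK. Qed.

Lemma oquot_leP a b :
  oquot_le (oquot_pi a) (oquot_pi b) <-> exists2 c, C c & a <= b + c.
Proof.
split=> [/asboolP[a' [b' [/oquot_piE aa' /oquot_piE bb' ab]]]|[c Cc abc]].
  exists ((a - a') - (b - b')); first exact: convB.
  have -> : b + (a - a' - (b - b')) = (a - a') + b'.
    by rewrite opprB addrCA [b + _]addrC subrK.
  by rewrite -{1}[a](subrK a') oag_leD2.
apply/asboolP; exists a, (b + c); split=> //; apply/oquot_piE.
rewrite opprD addNKr -sub0r; apply: convB => //; exact: conv0.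
Qed.

Lemma oquot_le_refl : reflexive oquot_le.
Proof.
move=> x; have [a ->] := oquot_pi_surj x; apply/oquot_leP.
by exists 0; [exact: conv0|rewrite addr0].
Qed.

Lemma oquot_le_anti : antisymmetric oquot_le.
Proof.
move=> x y; have [a ->] := oquot_pi_surj x; have [b ->] := oquot_pi_surj y.
case/andP => /oquot_leP[c Cc ac] /oquot_leP[c' Cc' bc'].
apply/oquot_piE; apply: (@conv_convex _ C (- c') (a - b) c) => //.
  by rewrite -sub0r; apply: convB => //; exact: conv0.
by apply/andP; split; rewrite -(oag_leD2 b) [b + (a - b)]addrCA subrr addr0 //
  -(oag_leD2 c') addrCA subrr addr0 addrC.
Qed.

Lemma oquot_le_trans : transitive oquot_le.
Proof.
move=> y x z; have [a ->] := oquot_pi_surj x; have [b ->] := oquot_pi_surj y.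
have [c ->] := oquot_pi_surj z.
case/oquot_leP => u Cu au /oquot_leP[v Cv bv]; apply/oquot_leP.
exists (v + u).
  rewrite -[u]opprK; apply: convB => //.
  by rewrite -sub0r; apply: convB => //; exact: conv0.
by apply: le_trans au _; rewrite addrA ![_ + u]addrC oag_leD2.
Qed.

Lemma oquot_le_total : total oquot_le.
Proof.
move=> x y; have [a ->] := oquot_pi_surj x; have [b ->] := oquot_pi_surj y.
by have [ab|/ltW ba] := leP a b; apply/orP; [left|right]; apply/oquot_leP;
  exists 0; rewrite ?addr0//; exact: conv0.
Qed.

Lemma oquot_leD2l z x y : oquot_le x y -> oquot_le (z + x) (z + y).
Proof.
have [a ->] := oquot_pi_surj x; have [b ->] := oquot_pi_surj y.
have [c ->] := oquot_pi_surj z; rewrite -!oquot_piD.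
case/oquot_leP => u Cu au; apply/oquot_leP; exists u => //.
by rewrite -addrA oag_leD2.
Qed.

HB.instance Definition _ := Order.Le_isPOrder.Build ring_display oquot
  oquot_le_refl oquot_le_anti oquot_le_trans.
HB.instance Definition _ := Order.POrder_isTotal.Build ring_display oquot
  oquot_le_total.
HB.instance Definition _ := POrderedZmodule_isOrderedAbelianGroup.Build oquot
  oquot_le_total oquot_leD2l.

End Quotient.

Arguments oquot_pi {G} C x.

Definition divisible (V : zmodType) : Prop :=
  forall (n : nat) (x : V), (0 < n)%N -> exists y : V, y *+ n = x.

Definition Zgroup (G : oagType) : Prop :=
  exists C : convSubgroup G,
    (exists f : {additive int -> G},
       {mono f : m n / m <= n} /\ range f = conv_set C) /\
    divisible (oquot C).

(* Main.v *)
(* Well-order the group and let U be the shortest initial segment mapping onto a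
   cofinal subset of D: U has cardinality cf(D) and every proper initial segment
   of U is too small to be cofinal.  If a nonprincipal cut (D, E) is symmetric,
   the same U serves D and E, and recursion along U gives increasing points of D
   and decreasing points of E bounding a chain of intervals with empty
   intersection.  Conversely the end points of a chain of intervals with empty
   intersection form a nonprincipal cut, and a cofinal set of end points on one
   side selects a cofinal set of end points on the other.

   Nonprincipal cuts of G are the preimages of the cuts of G/Z.  Taking preimages
   preserves cofinalities, except that 1 becomes the countable infinite one.

   When all cuts of an ordered group are asymmetric, the group is divisible: a
   missing quotient a/n would define a symmetric cut. *)

Require Import Defs.
From HB Require Import structures.
From mathcomp Require Import all_boot all_order all_algebra.
From mathcomp Require Import all_classical.

Set Implicit Arguments.
Unset Strict Implicit.
Unset Printing Implicit Defensive.

Import Order.TTheory GRing.Theory Num.Theory.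

Local Open Scope classical_set_scope.
Local Open Scope card_scope.
Local Open Scope ring_scope.

(** * Well-orders: recursion along them and shortest initial segments *)

Section WellOrder.
Variables (T : Type) (lt : T -> T -> Prop).

Definition strict_well_order : Prop :=
  [/\ well_founded lt, forall x y z, lt x y -> lt y z -> lt x z &
      forall x y, [\/ x = y, lt x y | lt y x]].

Definition seg (u : T) : set T := [set v | lt v u].

(** Transfinite recursion in which the step sees only the set of earlier values, as suffices for
    choosing a point avoiding or bounding them. *)
Lemma wf_image_rec (B : Type) (H : T -> set B -> B) : well_founded lt ->
  exists phi : T -> B, forall u, phi u = H u (phi @` seg u).
Proof.
move=> wf.
pose F u (rec : forall v, lt v u -> B) :=
  H u [set b | exists v (vu : lt v u), rec v vu = b].
exists (Fix wf (fun=> B) F) => u; rewrite Fix_eq; last first.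
  by move=> x f g fg; congr H; apply/seteqP; split=> b [v [vx <-]];
    exists v, vx; rewrite fg.
congr H; apply/seteqP; split=> b; first by move=> [v [vu <-]]; exists v.
by move=> [v vu <-]; exists v, vu.
Qed.

Lemma wf_least (P : T -> Prop) u : well_founded lt -> P u ->
  exists2 v, P v & forall w, lt w v -> ~ P w.
Proof.
move=> wf; elim/(well_founded_ind wf): u => u IH Pu.
have [[v [vu Pv]]|noP] := pselect (exists v, lt v u /\ P v); first exact: IH Pv.
by exists u => // w wu Pw; apply: noP; exists w.
Qed.

(** If some [seg u] satisfies [P], the segment below the least such [u] works; otherwise [setT]
    does. *)
Lemma least_initial_segment (P : set T -> Prop) : strict_well_order ->
  P setT -> exists U : set T,
    [/\ P U, forall u v, U u -> lt v u -> U v & forall u, U u -> ~ P (seg u)].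
Proof.
move=> [wf tr _] PT.
have [[u Pu]|noP] := pselect (exists u, P (seg u)); last first.
  by exists setT; split=> // u _ Pu; apply: noP; exists u.
have [v Pv vmin] := @wf_least (P \o seg) u wf Pu.
exists (seg v); split=> [//|x y|w /vmin//].
by rewrite /seg/= => xv yx; exact: tr yx xv.
Qed.

End WellOrder.

(** Totality and transitivity come from least elements of pairs and triples, well-foundedness from a
    least inaccessible element. *)
Lemma exists_strict_well_order (T : eqType) :
  exists lt : T -> T -> Prop, strict_well_order lt.
Proof.
have [R wo] := wochoice.well_ordering_principle T.
have minR (A : set T) x : A x -> exists2 z, A z & forall y, A y -> R z y.
  move=> Ax; have [|z [[zA zmin] _]] := wo (fun y => `[< A y >]).
    by exists x; apply/asboolP.
  exists z; first exact/asboolP.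
  by move=> y Ay; apply: zmin; apply/asboolP.
have anti x y : R x y -> R y x -> x = y.
  move=> xy yx; apply: (@wochoice.wo_chain_antisymmetric _ R predT) => //.
  - exact: wochoice.withinW.
  - by rewrite xy.
have tot x y : R x y \/ R y x.
  have [|z [->|->] zmin] := minR [set x; y] x; first by left.
    by left; apply: zmin; right.
  by right; apply: zmin; left.
have tr x y z : R x y -> R y z -> R x z.
  have [|w wxyz wmin] := minR [set t | [\/ t = x, t = y | t = z]] x.
    by constructor 1.
  case: wxyz wmin => -> wmin xy yz.
  - by apply: wmin; constructor 3.
  - by rewrite (anti x y)//; apply: wmin; constructor 1.
  - by rewrite -(anti y z)//; apply: wmin; constructor 2.
exists (fun x y => R x y /\ x <> y); split.
- move=> x; apply: contrapT => nx.
  have [z nz zmin] := minR [set y | ~ Acc (fun x y => R x y /\ x <> y) y] x nx.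
  apply: nz; constructor => y [yz neyz]; apply: contrapT => ny.
  by apply: neyz; apply: anti => //; exact: zmin.
- move=> x y z [xy nxy] [yz nyz]; split; first exact: tr yz.
  by move=> xz; apply: nyz; apply: anti => //; rewrite -xz.
- move=> x y; have [->|/eqP nxy] := eqVneq x y; first by constructor 1.
  have [xy|yx] := tot x y; first by constructor 2.
  by constructor 3; split=> // yx'; apply: nxy.
Qed.

(** * Existence of cofinalities and monotone cofinal families *)

Section Cofinality.
Context {d : Order.disp_t} {T : orderType d}.
Implicit Types (r : rel T) (D E K U : set T) (lt : T -> T -> Prop).

(** This expresses cf(D) <= |U| without cardinal numbers. *)
Definition cofinality_le r D U : Prop :=
  exists2 K, cofinal_in r D K & K #<= U.

Lemma cofinality_le_minimal lt r D U K : strict_well_order lt ->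
  (forall u v, U u -> lt v u -> U v) ->
  (forall u, U u -> ~ cofinality_le r D (seg lt u)) ->
  cofinal_in r D K -> U #<= K.
Proof.
move=> [wf _ tri] Uinit Umin Kcof.
have [->|/set0P[u0 Uu0]] := eqVneq U set0; first exact: card_ge0.
have [phi phiE] := wf_image_rec (fun u S => xget u0 (K `\` S)) wf.
have phiK u : U u -> (K `\` (phi @` seg lt u)) (phi u).
  move=> Uu; rewrite [phi u]phiE; case: xgetP => [x -> //|noK].
  exfalso; apply: (Umin u Uu); exists K => //.
  apply: card_le_trans (card_image_le phi _); apply: subset_card_le.
  by move=> x Kx; apply: contrapT => nx; exact: (noK x).
have nlt u v : U v -> lt u v -> phi u <> phi v.
  by move=> Uv uv e; have [_] := phiK v Uv; apply; exists u.
have phi_inj : {in U &, injective phi}.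
  move=> u v /set_mem Uu /set_mem Uv e.
  by have [//|uv|vu] := tri u v; [case: (nlt u v)|case: (nlt v u)].
rewrite -(card_le_eql (inj_card_eq phi_inj)); apply: subset_card_le.
by move=> _ [u /phiK[Kphi _] <-].
Qed.

Lemma exists_has_cof r D : reflexive r -> exists K, has_cof r D K.
Proof.
move=> rr; have [lt wo] := exists_strict_well_order T.
have DT : cofinality_le r D setT.
  by exists D; [split=> // x Dx; exists x|exact: card_leT].
have [U [[K Kcof KU] Uinit Umin]] := least_initial_segment wo DT.
exists K; split=> // K' K'cof.
have UK' := cofinality_le_minimal wo Uinit Umin K'cof.
exact: card_le_trans KU UK'.
Qed.

Lemma has_cof_card_eq r D K K' : has_cof r D K -> has_cof r D K' -> K #= K'.
Proof.
by move=> [Kc Km] [K'c K'm]; apply/card_eqPle; split; [exact: Km|exact: K'm].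
Qed.

(* Beyond [f u], [x u] only has to bound the earlier [x v]; they are not
   cofinal because there are too few of them. *)
Lemma monotone_cofinal_tower lt r D U : strict_well_order lt ->
  reflexive r -> transitive r -> total r -> D !=set0 ->
  (forall u v, U u -> lt v u -> U v) -> cofinality_le r D U ->
  (forall u, U u -> ~ cofinality_le r D (seg lt u)) ->
  exists x : T -> T, [/\ cofinal_in r D (x @` U), U !=set0 &
    forall u v, U u -> lt v u -> r (x v) (x u)].
Proof.
move=> [wf _ tri] rr rtr rtot [d0 Dd0] Uinit [K [KD Kcof] KU] Umin.
have [k0 Kk0 _] := Kcof d0 Dd0.
have /pfcard_geP[K0|[f]] := KU; first by rewrite K0 in Kk0.
have fD u : U u -> D (f u) by move=> Uu; apply: KD; exact: funS.
have [u0 Uu0 _] : (f @` U) k0 by exact: surj.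
have [x xE] := wf_image_rec
  (fun u S => xget d0 [set b | [/\ D b, r (f u) b & forall s, S s -> r s b]]) wf.
have xP u : U u -> [/\ D (x u), r (f u) (x u) &
    forall v, lt v u -> r (x v) (x u)].
  elim/(well_founded_ind wf): u => u IH Uu.
  suff [Dxu fxu xxu] : [set b | [/\ D b, r (f u) b &
      forall s, (x @` seg lt u) s -> r s b]] (x u).
    by split=> // v vu; apply: xxu; exists v.
  rewrite [x u in X in _ X]xE; case: xgetP => [b -> //|nob]; exfalso.
  apply: (Umin u Uu); exists (x @` seg lt u); last exact: card_image_le.
  split=> [_ [v vu <-]|b Db]; first by have [] := IH v vu (Uinit _ _ Uu vu).
  (* By [noy] and totality, [b] bounds all earlier values; the larger of [b] and [f u] is then an
     admissible value, against [nob]. *)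
  apply: contrapT => noy.
  have xb v : lt v u -> r (x v) b.
    move=> vu; have /orP[//|bxv] := rtot (x v) b.
    by exfalso; apply: noy; exists (x v) => //; exists v.
  have /orP[fub|bfu] := rtot (f u) b.
    by apply: (nob b); split=> // _ [v vu <-]; exact: xb.
  apply: (nob (f u)); split=> [|//|_ [v vu <-]]; first exact: fD.
  exact: rtr (xb v vu) bfu.
exists x; split; [|by exists u0|by move=> u v /xP[_ _]; exact].
split=> [_ [u /xP[Dxu _ _] <-] //|y /Kcof[k Kk yk]].
have [u Uu fuk] : (f @` U) k by exact: surj.
exists (x u); first by exists u.
by have [_ fx _] := xP u Uu; apply: rtr yk _; rewrite -fuk.
Qed.

End Cofinality.

(** * Spherical completeness and asymmetry of nonprincipal cuts *)

Section SphericalCompleteness.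
Context {d : Order.disp_t} {T : orderType d}.
Implicit Types D E : set T.
Local Open Scope order_scope.

Lemma cutP D E : cut D E <-> [/\ D !=set0, E !=set0,
  forall x, D x \/ E x & forall x y, D x -> E y -> x < y].
Proof.
split=> -[D0 E0 DE DltE]; split=> //; last first.
  by apply/seteqP; split=> // x _; exact: DE.
by move=> x; have : (D `|` E) x by rewrite DE.
Qed.

Lemma not_principal_above D E x :
  ~ principal_cut D E -> D x -> exists2 y, D y & x < y.
Proof.
move=> np Dx; apply: contrapT => noy; apply: np; left; exists x => // y Dy.
by rewrite leNgt; apply/negP => xy; apply: noy; exists y.
Qed.

Lemma not_principal_below D E x :
  ~ principal_cut D E -> E x -> exists2 y, E y & y < x.
Proof.
move=> np Ex; apply: contrapT => noy; apply: np; right; exists x => // y Ey.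
by rewrite leNgt; apply/negP => xy; apply: noy; exists y.
Qed.

Lemma symmetric_cut_empty_chain D E : cut D E -> ~ principal_cut D E ->
  ~ asymmetric_cut D E -> ~ spherically_complete T.
Proof.
move=> /cutP[D0 E0 DE DltE] np nasym sph.
have [lt wo] := exists_strict_well_order T.
have [K Kcof] := @exists_has_cof _ T <=%O D le_refl.
have [L Lcof] := @exists_has_cof _ T >=%O E le_refl.
have KL : K #= L.
  by apply: contrapT => /negP nKL; apply: nasym; exists K, L.
(* Symmetry of the cut lets a segment that is shortest for [D] be shortest for [E] too, so both
   towers have the same index set. *)
have leDE U : cofinality_le <=%O D U <-> cofinality_le >=%O E U.
  split=> -[M Mcof MU].
    exists L; first by have [] := Lcof.
    rewrite -(card_le_eql KL); apply: card_le_trans MU.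
    by case: Kcof => _; exact.
  exists K; first by have [] := Kcof.
  by rewrite (card_le_eql KL); apply: card_le_trans MU; case: Lcof => _; exact.
have DT : cofinality_le <=%O D setT.
  by exists K; [case: Kcof|exact: card_leT].
have [U [UD Uinit Umin]] := least_initial_segment wo DT.
have [x [[xD xcof] [u0 Uu0] xmono]] := monotone_cofinal_tower wo
  le_refl le_trans le_total D0 Uinit UD Umin.
have [||y [[yE ycof] _ ymono]] :=
    @monotone_cofinal_tower _ T lt >=%O E U wo le_refl ge_trans ge_total E0 Uinit.
- exact/leDE.
- by move=> u Uu /leDE; exact: Umin.
have xy u : U u -> x u < y u.
  by move=> Uu; apply: DltE; [apply: xD|apply: yE]; exists u.
have [||| z zI] := sph [set B | exists2 u, U u & B = `[x u, y u]%classic].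
- by exists `[x u0, y u0]%classic, u0.
- by move=> _ [u Uu ->]; exists (x u), (y u); split=> //; exact/ltW/xy.
- move=> _ _ [u Uu ->] [v Uv ->].
  have sub s t : U s -> lt t s -> `[x s, y s] `<=` `[x t, y t].
    move=> Us ts z /=; rewrite !in_itv/= => /andP[xz zy].
    by rewrite (le_trans (xmono _ _ Us ts) xz) (le_trans zy (ymono _ _ Us ts)).
  have [_ _ tri] := wo.
  by have [->|uv|vu] := tri u v; [left|right; exact: sub|left; exact: sub].
have {}zI u : U u -> x u <= z <= y u.
  by move=> Uu; have := zI `[x u, y u]%classic; rewrite /= in_itv; apply; exists u.
(* A common point in [D] is exceeded by some [x u], since [D] has no maximum and the [x u] are
   cofinal; dually in [E]. *)
have [Dz|Ez] := DE z.
- have [w Dw zw] := not_principal_above np Dz.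
  have [_ [u Uu <-] wxu] := xcof w Dw.
  have /andP[xz _] := zI u Uu.
  by have := lt_le_trans zw (le_trans wxu xz); rewrite ltxx.
- have [w Ew wz] := not_principal_below np Ez.
  have [_ [u Uu <-] yuw] := ycof w Ew.
  have /andP[_ zy] := zI u Uu.
  by have := le_lt_trans (le_trans zy yuw) wz; rewrite ltxx.
Qed.

Lemma spherically_complete_sym_d_complete :
  spherically_complete T -> symmetrically_d_complete T.
Proof.
move=> sph D E DE np; apply: contrapT => nasym.
exact: symmetric_cut_empty_chain DE np nasym sph.
Qed.

Lemma sym_d_complete_spherically_complete :
  symmetrically_d_complete T -> spherically_complete T.
Proof.
move=> sdc F [B0 FB0] Fitv Fchain; apply: contrapT => noI.
pose I := [set p : T * T | p.1 <= p.2 /\ F `[p.1, p.2]%classic].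
have Ichain p q : I p -> I q ->
    (q.1 <= p.1 /\ p.2 <= q.2) \/ (p.1 <= q.1 /\ q.2 <= p.2).
  move=> [lep Fp] [leq Fq].
  have [sub|sub] := Fchain _ _ Fp Fq; [left|right].
    have := sub p.1; have := sub p.2.
    rewrite /= !in_itv/= !lexx lep/= => /(_ isT)/andP[_ ->].
    by move=> /(_ isT)/andP[-> _].
  have := sub q.1; have := sub q.2.
  rewrite /= !in_itv/= !lexx leq/= => /(_ isT)/andP[_ ->].
  by move=> /(_ isT)/andP[-> _].
have Ile p q : I p -> I q -> p.1 <= q.2.
  move=> Ip Iq; have [[_]|[+ _]] := Ichain p q Ip Iq.
    by apply: le_trans; case: Ip.
  by move=> /le_trans; apply; case: Iq.
have noz z : ~ forall p, I p -> p.1 <= z <= p.2.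
  move=> zI; apply: noI; exists z => B FB.
  have [a [b [ab BE]]] := Fitv B FB; rewrite BE /= in_itv/=.
  by apply: (zI (a, b)); split=> //=; rewrite -BE.
(* The closures of the left ends downwards and of the right ends upwards. A point in both or in
   neither, a maximum of [D] or a minimum of [E] would lie in all the intervals. *)
pose D := [set x | exists2 p, I p & x <= p.1].
pose E := [set x | exists2 p, I p & p.2 <= x].
have D1 p : I p -> D p.1 by exists p.
have E2 p : I p -> E p.2 by exists p.
have DltE x y : D x -> E y -> x < y.
  move=> [p Ip xp] [q Iq qy]; rewrite lt_neqAle.
  rewrite (le_trans xp (le_trans (Ile _ _ Ip Iq) qy)) andbT.
  apply/eqP => xy; apply: (noz x) => s Is.
  by rewrite {1}xy (le_trans (Ile _ _ Is Iq) qy)// (le_trans xp)// Ile.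
have [a0 [b0 [ab0 B0E]]] := Fitv B0 FB0.
have I0 : I (a0, b0) by split=> //=; rewrite -B0E.
have cutDE : cut D E.
  apply/cutP; split=> //.
  - by exists a0; exact: (D1 _ I0).
  - by exists b0; exact: (E2 _ I0).
  - move=> x; apply: contrapT => /not_orP[nD nE].
    apply: (noz x) => p Ip; rewrite !leNgt; apply/andP; split; apply/negP => lx.
      by apply: nD; exists p => //; exact: ltW.
    by apply: nE; exists p => //; exact: ltW.
have np : ~ principal_cut D E.
  case=> -[m + mmax].
    move=> Dm; apply: (noz m) => p Ip.
    by rewrite mmax ?(ltW (DltE _ _ Dm (E2 _ Ip)))//; exact: D1.
  move=> Em; apply: (noz m) => p Ip.
  by rewrite (mmax _ (E2 _ Ip)) (ltW (DltE _ _ (D1 _ Ip) Em)).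
have [K [L [[Kcof Kmin] [Lcof Lmin] /negP]]] := sdc D E cutDE np; apply.
apply/card_eqPle; split.
(* For each [y] in [L], select an interval with right end at most [y]; the left ends selected are
   cofinal in [D], which gives [K #<= L]. The pair [(y, y)] is a dummy outside [L]. *)
- have /choice[p pP] : forall y, exists p, L y -> I p /\ p.2 <= y.
    move=> y; have [Ly|nLy] := pselect (L y); last by exists (y, y).
    by have [p Ip py] := Lcof.1 y Ly; exists p.
  apply: card_le_trans (card_image_le (fst \o p) L); apply: Kmin; split.
    by move=> _ [y /pP[Ip _] <-]; exact: D1.
  move=> x Dx; apply: contrapT => noy.
  have above y : L y -> (p y).1 < x.
    by move=> Ly; rewrite ltNge; apply/negP => xp; apply: noy;
      exists (p y).1 => //; exists y.
  (* A selected interval ending strictly below [q.2] is nested in that of [q], so its left end is at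
     least [q.1], hence at least [x]. *)
  have [q Iq xq] := Dx.
  have [m Em mq] := not_principal_below np (E2 _ Iq).
  have [y Ly ym] := Lcof.2 m Em.
  have [Ip py] := pP y Ly.
  have [[+ _]|[_]] := Ichain _ _ Ip Iq.
    by move=> /(le_trans xq); rewrite leNgt above.
  by move=> /le_trans/(_ py)/le_trans/(_ ym); rewrite leNgt mq.
- have /choice[p pP] : forall x, exists p, K x -> I p /\ x <= p.1.
    move=> x; have [Kx|nKx] := pselect (K x); last by exists (x, x).
    by have [p Ip py] := Kcof.1 x Kx; exists p.
  apply: card_le_trans (card_image_le (snd \o p) K); apply: Lmin; split.
    by move=> _ [y /pP[Ip _] <-]; exact: E2.
  move=> x Ex; apply: contrapT => noy.
  have below y : K y -> x < (p y).2.
    by move=> Ky; rewrite ltNge; apply/negP => xp; apply: noy;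
      exists (p y).2 => //; exists y.
  have [q Iq qx] := Ex.
  have [m Dm qm] := not_principal_above np (D1 _ Iq).
  have [y Ky my] := Kcof.2 m Dm.
  have [Ip py] := pP y Ky.
  have [[_ pq]|[pq _]] := Ichain _ _ Ip Iq.
    by have := le_trans pq qx; rewrite leNgt below.
  by have := le_trans my (le_trans py pq); rewrite leNgt qm.
Qed.

End SphericalCompleteness.

(** * Comparing cofinalities of different sets *)

Section CofinalityComparison.
Context {d : Order.disp_t} {T : orderType d}.
Implicit Types (r : rel T) (D E K L : set T).

Lemma uncountable_cofP r D K :
  has_cof r D K -> uncountable_cof r D <-> ~ countable K.
Proof.
move=> Kcof; split=> [[K' K'cof]|]; last by exists K.
by rewrite (eq_countable (has_cof_card_eq Kcof K'cof)).
Qed.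

Lemma has_cof_le_of_image r r' D E K L (phi : T -> T) :
  cofinal_in r D K -> has_cof r' E L -> (forall x, D x -> E (phi x)) ->
  (forall y, E y -> exists2 x, D x &
     forall x', D x' -> r x x' -> r' y (phi x')) -> L #<= K.
Proof.
move=> [KD Kcof] [_ Lmin] phiE phicof.
apply: card_le_trans (card_image_le phi K); apply: Lmin; split.
  by move=> _ [x /KD/phiE ? <-].
move=> y /phicof[x Dx xy]; have [x' Kx' xx'] := Kcof x Dx.
by exists (phi x'); [exists x'|apply: xy => //; exact: KD].
Qed.

(** A finite subset of [D] is bounded by some [b] in [D], and a point of [D] not below [b] is below
    no point of that subset. *)
Lemma cofinal_in_infinite r D K : transitive r -> total r -> D !=set0 ->
  (forall x, D x -> exists2 y, D y & ~ r y x) ->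
  cofinal_in r D K -> infinite_set K.
Proof.
move=> rtr rtot [d0 Dd0] nomax [KD Kcof] /finite_seqP[s Ks].
have [b Db sb] : exists2 b, D b & forall x, x \in s -> r x b.
  have : forall x, x \in s -> D x by move=> x xs; apply: KD; rewrite Ks.
  elim: s {Ks} => [|x s IH] sD; first by exists d0.
  have [|b Db sb] := IH; first by move=> y ys; apply: sD; rewrite inE ys orbT.
  have /orP[xb|bx] := rtot x b.
    by exists b => // y; rewrite inE => /orP[/eqP->|/sb].
  exists x => [|y]; first by apply: sD; rewrite mem_head.
  rewrite inE => /orP[/eqP->|/sb yb]; first by have /orP[] := rtot x x.
  exact: rtr yb bx.
have [y Dy] := nomax b Db; apply.
have [k Kk yk] := Kcof y Dy; apply: rtr yk (sb k _).
by rewrite Ks in Kk.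
Qed.

End CofinalityComparison.

(** * Divisibility of ordered groups all of whose cuts are asymmetric *)

Section OrderedAbelianGroups.
Variable G : oagType.
Implicit Types x y z a b : G.

Lemma oag_ltD2 z x y : (z + x < z + y) = (x < y).
Proof. by rewrite !ltNge oag_leD2. Qed.

Lemma oag_leD x y a b : x <= y -> a <= b -> x + a <= y + b.
Proof.
move=> xy ab; apply: (@le_trans _ _ (x + b)); first by rewrite oag_leD2.
by rewrite ![_ + b]addrC oag_leD2.
Qed.

Lemma oag_ltleD x y a b : x < y -> a <= b -> x + a < y + b.
Proof.
move=> xy ab; apply: (@le_lt_trans _ _ (x + b)); first by rewrite oag_leD2.
by rewrite ![_ + b]addrC oag_ltD2.
Qed.

Lemma oag_subr_gt0 x y : (0 < y - x) = (x < y).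
Proof. by rewrite -(oag_ltD2 x 0) addr0 addrC subrK. Qed.

Lemma oag_leN2 x y : (- x <= - y) = (y <= x).
Proof. by rewrite -(oag_leD2 (x + y) (- x)) addrK addrAC subrr add0r. Qed.

Lemma oag_lerBr x y z : (x <= y - z) = (x + z <= y).
Proof. by rewrite -(oag_leD2 z x) [z + (y - z)]addrC subrK addrC. Qed.

Lemma oag_lerBl x y z : (x - z <= y) = (x <= y + z).
Proof. by rewrite -(oag_leD2 z (x - z)) [z + (x - z)]addrC subrK addrC. Qed.

Lemma oag_leMn n x y : x <= y -> x *+ n <= y *+ n.
Proof.
by move=> xy; elim: n => [|n IH]; rewrite ?mulr0n// !mulrS; exact: oag_leD.
Qed.

Lemma oag_ltMn n x y : x *+ n < y *+ n -> x < y.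
Proof.
by move=> xy; rewrite ltNge; apply/negP => /(oag_leMn n); rewrite leNgt xy.
Qed.

Lemma oag_leMn2 n x y : (0 < n)%N -> x *+ n <= y *+ n -> x <= y.
Proof.
case: n => // n _ xy; rewrite leNgt; apply/negP => yx.
by move: xy; rewrite leNgt !mulrS oag_ltleD// oag_leMn// ltW.
Qed.

Lemma oag_mulrn_ge x n : 0 <= x -> (0 < n)%N -> x <= x *+ n.
Proof.
case: n => // n x0 _; rewrite mulrS -{1}[x]addr0 oag_leD2.
by rewrite -(mul0rn _ n) oag_leMn.
Qed.

Lemma oag_mulrn_le x n : x <= 0 -> (0 < n)%N -> x *+ n <= x.
Proof.
case: n => // n x0 _; rewrite mulrS -[leRHS]addr0 oag_leD2.
by rewrite -(mul0rn _ n) oag_leMn.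
Qed.

Hypothesis cut_asymmetric :
  forall D E : set G, cut D E -> asymmetric_cut D E.

(* Otherwise [m * u < c] and [2 c < m * u] define a cut with a [y] such that
   [x |-> y - x] exchanges its two sides. *)
Lemma approximate_division (c : G) (m : nat) : 0 < c -> (0 < m)%N ->
  exists u, c <= u *+ m <= c *+ 2.
Proof.
move=> c0 m0; apply: contrapT => nou.
have c_ge0 := ltW c0.
pose D := [set x | x *+ m < c]; pose E := [set x | c *+ 2 < x *+ m].
have nDE x : ~ E x -> D x.
  move=> /negP; rewrite -leNgt => xc; rewrite /D/= ltNge; apply/negP => cx.
  by apply: nou; exists x; rewrite cx.
have DltE x y : D x -> E y -> x < y.
  move=> Dx Ey; apply: (@oag_ltMn m); apply: lt_trans Dx _.
  by apply: le_lt_trans Ey; exact: oag_mulrn_ge.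
have D0 : D 0 by rewrite /D/= mul0rn.
have Ec : E c.
  apply: contrapT => /nDE; rewrite /D/= ltNge; apply/negP/negPn.
  exact: oag_mulrn_ge.
have cutDE : cut D E.
  apply/cutP; split=> //; [by exists 0|by exists c|].
  by move=> x; have [Ex|/nDE] := pselect (E x); [right|left].
(* Otherwise every element of [E] splits into two elements of [E]. Splitting repeatedly gives
   [c *+ k < z *+ m] for all [k], which fails for [z = c] and [k = m]. *)
have [y Ey ymin] : exists2 y, E y & forall z, E z -> ~ E (y - z).
  apply: contrapT => noy.
  have large k z : E z -> c *+ k < z *+ m.
    elim: k z => [|k IH] z Ez.
      by rewrite mulr0n; apply: le_lt_trans Ez; rewrite -(mul0rn _ 2) oag_leMn.
    have [w Ew Ezw] : exists2 w, E w & E (z - w).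
      by apply: contrapT => now; apply: noy; exists z => // w Ew Ezw;
        apply: now; exists w.
    rewrite -[z](subrK w) mulrnDl mulrS; apply: oag_ltleD; last exact/ltW/IH.
    by apply: le_lt_trans Ezw; exact: oag_mulrn_ge.
  by have := large m c Ec; rewrite ltxx.
(* If [x] and [y - x] were both in [D], then [y *+ m <= c *+ 2], against [E y]; this is why the gap
   reaches up to [c *+ 2]. *)
have reflE x : D x -> E (y - x).
  move=> Dx; apply: contrapT => /nDE Dyx; move: Ey; rewrite /E/= ltNge.
  apply/negP/negPn; rewrite -[y](subrK x) mulrnDl mulr2n.
  by apply: oag_leD; exact: ltW.
have reflD x : E x -> D (y - x) by move=> /ymin/nDE.
have leB x z : y - z <= x -> y - x <= z by rewrite !oag_lerBl addrC.
have geB x z : x <= y - z -> z <= y - x by rewrite !oag_lerBr addrC.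
have [K [L [Kcof Lcof /negP]]] := cut_asymmetric cutDE; apply.
apply/card_eqPle; split.
  apply: (has_cof_le_of_image Lcof.1 Kcof reflD) => x Dx.
  by exists (y - x); [exact: reflE|move=> z _ /geB].
apply: (has_cof_le_of_image Kcof.1 Lcof reflE) => x Ex.
by exists (y - x); [exact: reflD|move=> z _ /leB].
Qed.

(* If [a] is not divisible by [n], approximate division exchanges the sides of
   the cut at [a / n] without increasing the defect [|a - n * x|]. *)
Lemma cut_asymmetric_divisible : divisible G.
Proof.
move=> n a n0; apply: contrapT => noy.
pose D := [set x | x *+ n < a]; pose E := [set x | a < x *+ n].
have DltE x y : D x -> E y -> x < y.
  by move=> Dx Ey; apply: (@oag_ltMn n); exact: lt_trans Dx Ey.
have DE x : D x \/ E x.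
  case: (ltgtP (x *+ n) a) => [xa|ax|xa]; [by left|by right|].
  by exfalso; apply: noy; exists x.
have Dle x y : D y -> x <= y -> D x.
  by move=> Dy xy; apply: le_lt_trans Dy; exact: oag_leMn.
have Ege x y : E y -> y <= x -> E x.
  by move=> Ey xy; apply: lt_le_trans Ey _; exact: oag_leMn.
have cutDE : cut D E.
  apply/cutP; split=> //.
  - have [|E0] := DE 0; first by exists 0.
    have [|Ea] := DE a; first by exists a.
    exfalso; move: Ea E0; rewrite /E/= mul0rn ltNge => /negP + a0; apply.
    exact: oag_mulrn_le (ltW a0) n0.
  - have [D0|] := DE 0; last by exists 0.
    have [Da|] := DE a; last by exists a.
    exfalso; move: Da D0; rewrite /D/= mul0rn ltNge => /negP + a0; apply.
    exact: oag_mulrn_ge (ltW a0) n0.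
(* The inequality means [u *+ n - a <= a - x *+ n]: the image overshoots [a] by at most what [x]
   falls short. *)
have phiP x : exists u, D x -> E u /\ u *+ n + x *+ n <= a *+ 2.
  have [Dx|nDx] := pselect (D x); last by exists 0.
  have [|u /andP[cu uc]] := @approximate_division (a - x *+ n) n _ n0.
    by rewrite oag_subr_gt0.
  exists (x + u) => _.
  have xu : (x + u) *+ n + x *+ n <= a *+ 2.
    rewrite mulrnDl addrAC -mulr2n -[a](subrK (x *+ n)) mulrnDl [leRHS]addrC.
    by rewrite oag_leD2.
  split=> //.
  have [Dxu|//] := DE (x + u).
  by move: Dxu; rewrite /D/= ltNge mulrnDl addrC -oag_lerBl cu.
have psiP y : exists u, E y -> D u /\ a *+ 2 <= u *+ n + y *+ n.
  have [Ey|nEy] := pselect (E y); last by exists 0.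
  have [|u /andP[cu uc]] := @approximate_division (y *+ n - a) n _ n0.
    by rewrite oag_subr_gt0.
  exists (y - u) => _; split.
    have [//|Eyu] := DE (y - u).
    move: Eyu; rewrite /E/= ltNge mulrnBl oag_lerBl.
    by move: cu; rewrite oag_lerBl addrC => ->.
  rewrite mulrnBl addrAC -mulr2n oag_lerBr addrC -oag_lerBr.
  by rewrite -mulrnBl.
have /choice[phi {}phiP] := phiP; have /choice[psi {}psiP] := psiP.
have [K [L [Kcof Lcof /negP]]] := cut_asymmetric cutDE; apply.
apply/card_eqPle; split.
  apply: (has_cof_le_of_image Lcof.1 Kcof (phi := psi)) => [x /psiP[]//|x Dx].
  exists (phi x); first by have [] := phiP x Dx.
  (* From [z <= phi x] it follows that [x *+ n <= a *+ 2 - phi x *+ n <= a *+ 2 - z *+ n <= psi z *+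
     n]. *)
  move=> z Ez zx; have [_ xa] := phiP x Dx; have [_ az] := psiP z Ez.
  apply: (@oag_leMn2 n) => //; rewrite -(oag_leD2 (z *+ n)) [leRHS]addrC.
  apply: le_trans az; apply: le_trans xa; rewrite ![_ + x *+ n]addrC oag_leD2.
  exact: oag_leMn.
apply: (has_cof_le_of_image Kcof.1 Lcof (phi := phi)) => [x /phiP[]//|y Ey].
exists (psi y); first by have [] := psiP y Ey.
move=> z Dz yz; have [_ ya] := psiP y Ey; have [_ az] := phiP z Dz.
apply: (@oag_leMn2 n) => //; rewrite -(oag_leD2 (z *+ n)) [leLHS]addrC.
apply: le_trans az _; apply: le_trans ya _; rewrite ![_ + y *+ n]addrC oag_leD2.
exact: oag_leMn.
Qed.

End OrderedAbelianGroups.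

(** * Cardinal equality up to countable sets *)

Section CardEqOrCountable.
Implicit Types S T U V : Type.

(** The relation between a cofinality in [G/Z] and that of the preimage; the second alternative
    absorbs the passage from 1 to the countable infinite cofinality. *)
Definition card_eq_or_countable S T (A : set S) (B : set T) : Prop :=
  A #= B \/ countable A /\ countable B.

Lemma card_eq_or_countable_sym S T (A : set S) (B : set T) :
  card_eq_or_countable A B -> card_eq_or_countable B A.
Proof. by case=> [/card_esym|[]]; [left|right]. Qed.

Lemma card_eq_or_countableE S T (A : set S) (B : set T) :
  card_eq_or_countable A B -> countable A <-> countable B.
Proof. by case=> [/eq_countable->|[]]. Qed.

(** All four sets are countable or none is; the former is excluded, so both relations are true
    equalities. *)
Lemma card_eq_transfer S T U V (A : set S) (B : set T) (A' : set U)
    (B' : set V) :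
  card_eq_or_countable A A' -> card_eq_or_countable B B' ->
  ~ (countable A /\ countable B) -> A' #= B' -> A #= B.
Proof.
move=> AA' BB' nAB A'B'.
have cAB : countable A <-> countable B.
  rewrite (card_eq_or_countableE AA') (card_eq_or_countableE BB').
  by rewrite (eq_countable A'B').
case: AA' => [AA'|[cA _]]; last by exfalso; apply: nAB; split=> //; exact/cAB.
case: BB' => [BB'|[cB _]]; last by exfalso; apply: nAB; split=> //; exact/cAB.
exact: card_eq_trans AA' (card_eq_trans A'B' (card_esym BB')).
Qed.

End CardEqOrCountable.

(** * Cuts and cofinalities of [G] against those of [G/Z] *)

Section ZQuotient.
Variables (G : oagType) (e : G).
Hypothesis e_min : smallest_positive e.
Local Notation Q := (oquot (Zsub G)).
Local Notation pi := (oquot_pi (Zsub G)).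
Implicit Types (x y : G) (a b : Q).

Lemma oquot_pi_eqP x y : pi x = pi y <-> exists n : int, x = y + e *~ n.
Proof.
rewrite oquot_piE (ZsubP e_min); split=> [[n _ ne]|[n ->]].
  by exists n; rewrite ne addrC subrK.
by exists n => //; rewrite addrAC subrr add0r.
Qed.

Lemma oquot_pi_le x y : x <= y -> pi x <= pi y.
Proof.
by move=> xy; apply/oquot_leP; exists 0; rewrite ?addr0//; exact: conv0.
Qed.

Lemma oquot_pi_lt x y : pi x < pi y -> x < y.
Proof. by rewrite !ltNge; apply: contra; exact: oquot_pi_le. Qed.

Lemma oquot_pi_addMz x (n : int) : pi (x + e *~ n) = pi x.
Proof. by apply/oquot_pi_eqP; exists n. Qed.

Lemma oquot_pi_add_e x : pi (x + e) = pi x.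
Proof. by rewrite -(oquot_pi_addMz x 1). Qed.

Lemma lt_add_smallest x y : x < y -> x + e <= y.
Proof.
by move=> xy; rewrite addrC -oag_lerBr; apply: e_min.2; rewrite oag_subr_gt0.
Qed.

Lemma lt_addr_e x : x < x + e.
Proof. by rewrite -[ltLHS]addr0 oag_ltD2; case: e_min. Qed.

Section Cofinality.
Variables (r : rel G) (rb : rel Q).
Hypothesis r_refl : reflexive r.
Hypotheses (rb_trans : transitive rb) (rb_total : total rb).
Hypothesis pi_homo : forall x y, r x y -> rb (pi x) (pi y).
Hypothesis pi_lift : forall x y, rb (pi x) (pi y) -> pi x <> pi y -> r x y.

(** If [D] has a greatest class for [rb], that single coset of Z is cofinal in the preimage, and
    both sides are countable. Otherwise a section [s] and [pi] carry cofinal sets to cofinal sets.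
    Abstract [r] and [rb] cover coinitialities as well. *)
Lemma has_cof_preimage (D : set Q) (K : set G) (Kb : set Q) :
  has_cof r (pi @^-1` D) K -> has_cof rb D Kb ->
  card_eq_or_countable K Kb.
Proof.
move=> [[KD Kcof] Kmin] [[KbD Kbcof] Kbmin].
have rb_refl a : rb a a by have /orP[] := rb_total a a.
have /choice[s sK] : forall a : Q, exists x, pi x = a.
  by move=> a; have [x ->] := oquot_pi_surj a; exists x.
have [[m Dm mmax]|nomax] := pselect (exists2 m, D m & forall a, D a -> rb a m).
  right; split; last first.
    apply: (@card_le_trans _ _ _ [set m]); last exact: countable1.
    by apply: Kbmin; split=> [_ ->//|a /mmax]; exists m.
  apply: (@card_le_trans _ _ _ (range (fun n : int => s m + e *~ n))).
    apply: Kmin; split=> [_ [n _ <-]|x Dx].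
      by rewrite /= oquot_pi_addMz sK.
    have [xm|xm] := pselect (pi x = m).
      have /oquot_pi_eqP[n ->] : pi x = pi (s m) by rewrite sK.
      by exists (s m + e *~ n) => //; exists n.
    exists (s m); first by exists 0 => //; rewrite mulr0z addr0.
    by apply: pi_lift; rewrite sK //; exact: mmax.
  exact: card_le_trans (card_image_le _ _) (countableP _).
left; apply/card_eqPle; split.
  apply: card_le_trans (card_image_le s Kb); apply: Kmin; split.
    by move=> _ [a /KbD Da <-]; rewrite /= sK.
  (* A class strictly beyond that of [x] is needed because [pi_lift] compares only points of
     distinct classes. *)
  move=> x Dx; have [b Db nbx] : exists2 b, D b & ~ rb b (pi x).
    apply: contrapT => nob; apply: nomax; exists (pi x) => // b Db.
    by apply: contrapT => nbx; apply: nob; exists b.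
  have [k Kk bk] := Kbcof b Db.
  exists (s k); first by exists k.
  have xb : rb (pi x) b by have /orP[|/nbx] := rb_total (pi x) b.
  apply: pi_lift; rewrite sK; first exact: rb_trans bk.
  by move=> xk; apply: nbx; rewrite xk.
apply: card_le_trans (card_image_le pi K); apply: Kbmin; split.
  by move=> _ [x /KD Dx <-].
move=> a Da; have [x Kx ax] := Kcof (s a) (eq_ind_r D Da (sK a)).
by exists (pi x); [exists x|rewrite -(sK a); exact: pi_homo].
Qed.

End Cofinality.

Lemma has_cof_le_preimage (D : set Q) (K : set G) (Kb : set Q) :
  has_cof <=%O (pi @^-1` D) K -> has_cof <=%O D Kb ->
  card_eq_or_countable K Kb.
Proof.
apply: has_cof_preimage; [exact: le_refl|exact: le_trans|exact: le_total| |].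
  exact: oquot_pi_le.
by move=> x y xy /eqP nxy; apply/ltW/oquot_pi_lt; rewrite lt_neqAle nxy.
Qed.

Lemma has_cof_ge_preimage (D : set Q) (K : set G) (Kb : set Q) :
  has_cof >=%O (pi @^-1` D) K -> has_cof >=%O D Kb ->
  card_eq_or_countable K Kb.
Proof.
apply: has_cof_preimage; [exact: le_refl|exact: ge_trans|exact: ge_total| |].
  by move=> x y; exact: oquot_pi_le.
by move=> x y xy /eqP nxy; apply/ltW/oquot_pi_lt; rewrite lt_neqAle eq_sym nxy.
Qed.

(** As [D] has no maximum, it contains a point strictly above [x + e *+ k], hence at least
    [x + e *+ k.+1]. Negative multiples stay in [D] because it is closed downwards. *)
Lemma nonprincipal_cut_saturated (D E : set G) x y : cut D E ->
  ~ principal_cut D E -> D x -> pi x = pi y -> D y.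
Proof.
move=> /cutP[_ _ DE DltE] np Dx /esym/oquot_pi_eqP[n ->].
have Dle u v : D v -> u <= v -> D u.
  move=> Dv uv; have [//|Eu] := DE u.
  by have := DltE _ _ Dv Eu; rewrite ltNge uv.
have Dn (k : nat) : D (x + e *+ k).
  elim: k => [|k IH]; first by rewrite mulr0n addr0.
  have [z Dz xz] := not_principal_above np IH.
  by apply: Dle Dz _; rewrite mulrSr addrA; exact: lt_add_smallest.
case: n => k; first exact: Dn.
apply: Dle Dx _; rewrite -[leRHS]addr0 oag_leD2 -oppr0 oag_leN2.
by rewrite -(mul0rn _ k.+1); apply/oag_leMn/ltW; case: e_min.
Qed.

(** Both sides are unions of cosets of Z, so their images remain disjoint. *)
Lemma cut_image (D E : set G) : cut D E -> ~ principal_cut D E ->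
  [/\ cut (pi @` D) (pi @` E), D = pi @^-1` (pi @` D) & E = pi @^-1` (pi @` E)].
Proof.
move=> DEcut np; have /cutP[[x Dx] [y Ey] DE DltE] := DEcut.
have Dsat u v : D u -> pi u = pi v -> D v by exact: nonprincipal_cut_saturated np.
have notDE u : D u -> E u -> False by move=> Du /(DltE _ _ Du); rewrite ltxx.
have Esat u v : E u -> pi u = pi v -> E v.
  move=> Eu /esym vu; have [Dv|//] := DE v.
  by exfalso; apply: notDE Eu; exact: Dsat vu.
split.
- apply/cutP; split; [by exists (pi x), x|by exists (pi y), y| |].
    move=> a; have [z ->] := oquot_pi_surj a.
    by have [Dz|Ez] := DE z; [left|right]; exists z.
  move=> _ _ [u Du <-] [v Ev <-]; rewrite lt_neqAle oquot_pi_le ?andbT; last first.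
    exact/ltW/DltE.
  by apply/eqP => uv; apply: notDE Ev; exact: Dsat uv.
- by apply/seteqP; split=> [z Dz|z [u Du uz]]; [exists z|exact: Dsat uz].
- by apply/seteqP; split=> [z Ez|z [u Eu uz]]; [exists z|exact: Esat uz].
Qed.

(** An extremal element [m] is impossible, since [m + e] and [m - e] lie in the same class as
    [m]. *)
Lemma cut_preimage (D E : set Q) : cut D E ->
  cut (pi @^-1` D) (pi @^-1` E) /\ ~ principal_cut (pi @^-1` D) (pi @^-1` E).
Proof.
move=> /cutP[[a Da] [b Eb] DE DltE]; split.
  apply/cutP; split.
  - by have [x xa] := oquot_pi_surj a; exists x; rewrite /= -xa.
  - by have [x xb] := oquot_pi_surj b; exists x; rewrite /= -xb.
  - by move=> x; exact: DE.
  - by move=> x y Dx Ey; apply: oquot_pi_lt; exact: DltE.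
case=> -[m mDE mmax].
  have := mmax (m + e); rewrite /= oquot_pi_add_e => /(_ mDE).
  by rewrite leNgt lt_addr_e.
have := mmax (m - e); rewrite /= -(oquot_pi_add_e (m - e)) subrK => /(_ mDE).
by rewrite leNgt -{2}[m](subrK e) lt_addr_e.
Qed.

(** Both cofinalities of the preimage cut are infinite; being different, they are not both
    countable, so the asymmetry passes to the quotient and is strong there. *)
Lemma sym_d_complete_quotient :
  symmetrically_d_complete G -> strongly_symmetrically_complete Q.
Proof.
move=> sdc D E DE; have [DE' np] := cut_preimage DE.
have [K [L [Kcof Lcof nKL]]] := sdc _ _ DE' np.
have [Kb Kbcof] := @exists_has_cof _ Q <=%O D le_refl.
have [Lb Lbcof] := @exists_has_cof _ Q >=%O E le_refl.
have [D0 E0 _ _] := DE'.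
have Kinf : infinite_set K.
  apply: (cofinal_in_infinite le_trans le_total D0) Kcof.1 => x Dx.
  by have [y Dy xy] := not_principal_above np Dx; exists y => //; rewrite leNgt xy.
have Linf : infinite_set L.
  apply: (cofinal_in_infinite ge_trans ge_total E0) Lcof.1 => x Ex.
  by have [y Ey xy] := not_principal_below np Ex; exists y => //=; rewrite leNgt xy.
have nKLcount : ~ (countable K /\ countable L).
  move=> [Kc Lc]; move/negP: nKL; apply.
  exact: card_eq_trans (eq_card_nat Kc Kinf) (card_esym (eq_card_nat Lc Linf)).
have KKb := has_cof_le_preimage Kcof Kbcof.
have LLb := has_cof_ge_preimage Lcof Lbcof.
split.
  exists Kb, Lb; split=> //; apply: contra nKL.
  exact: card_eq_transfer KKb LLb nKLcount.
have [cK|ncK] := pselect (countable K); [right|left].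
  by exists Lb => // /(card_eq_or_countableE LLb) cL; apply: nKLcount.
by exists Kb => // /(card_eq_or_countableE KKb).
Qed.

(** Strong asymmetry is what survives: cofinalities 1 and aleph_0 in the quotient would both become
    aleph_0 in [G]. *)
Lemma quotient_sym_d_complete :
  strongly_symmetrically_complete Q -> symmetrically_d_complete G.
Proof.
move=> ssc D E DEcut np; have [DE' eqD eqE] := cut_image DEcut np.
have [[Kb [Lb [Kbcof Lbcof nKLb]]] unc] := ssc _ _ DE'.
have [K Kcof] := @exists_has_cof _ G <=%O D le_refl.
have [L Lcof] := @exists_has_cof _ G >=%O E le_refl.
exists K, L; split=> //; apply: contra nKLb.
rewrite eqD in Kcof; rewrite eqE in Lcof.
have KKb := card_eq_or_countable_sym (has_cof_le_preimage Kcof Kbcof).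
have LLb := card_eq_or_countable_sym (has_cof_ge_preimage Lcof Lbcof).
apply: card_eq_transfer KKb LLb _ => -[cK cL].
by case: unc => [/(uncountable_cofP Kbcof)|/(uncountable_cofP Lbcof)].
Qed.

Lemma uncountable_cof_quotient :
  uncountable_cof (<=%O : rel G) setT <-> uncountable_cof (<=%O : rel Q) setT.
Proof.
have [K Kcof] := @exists_has_cof _ G <=%O setT le_refl.
have [Kb Kbcof] := @exists_has_cof _ Q <=%O setT le_refl.
rewrite (uncountable_cofP Kcof) (uncountable_cofP Kbcof).
rewrite -(preimage_setT pi) in Kcof.
by rewrite (card_eq_or_countableE (has_cof_le_preimage Kcof Kbcof)).
Qed.

(** The embedding of the integers is [n |-> e *~ n], strictly increasing because [e] is positive. *)
Lemma Zgroup_of_divisible : divisible Q -> Zgroup G.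
Proof.
move=> divQ; exists (Zsub G); split=> //.
pose f (n : int) := e *~ n.
have fB : zmod_morphism f by move=> m n; exact: mulrzBr.
pose fM := GRing.isZmodMorphism.Build int G f fB.
pose fA : {additive int -> G} := HB.pack f fM.
exists fA; split; last by rewrite (ZsubP e_min).
apply: le_mono => m n mn; have [k ->] : exists k : nat, n = m + k.+1%:Z.
  move: mn; rewrite -subr_gt0; case nmE: (n - m) => [[|k]|] // _.
  by exists k; rewrite -nmE addrC subrK.
rewrite /= /f mulrzDr -[ltLHS]addr0 oag_ltD2.
by apply: (lt_le_trans e_min.1); apply: oag_mulrn_ge => //; exact/ltW/e_min.1.
Qed.

End ZQuotient.

(** * Negation exchanges cofinality and coinitiality *)

Section Reversal.
Variable G : oagType.
Implicit Types K : set G.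

Lemma has_cof_opp K :
  has_cof (<=%O : rel G) setT K -> has_cof (>=%O : rel G) setT (-%R @` K).
Proof.
move=> [[_ Kcof] Kmin]; split.
  split=> // x _; have [y Ky xy] := Kcof (- x) I.
  by exists (- y); [exists y|rewrite /= -oag_leN2 opprK].
move=> L [_ Lcof]; apply: card_le_trans (card_image_le _ _) _.
apply: card_le_trans (card_image_le -%R L); apply: Kmin; split=> // x _.
have [y Ly yx] := Lcof (- x) I.
by exists (- y); [exists y|rewrite -oag_leN2 opprK].
Qed.

Lemma uncountable_coinitiality :
  uncountable_cof (<=%O : rel G) setT -> uncountable_cof (>=%O : rel G) setT.
Proof.
move=> [K Kcof nK]; exists (-%R @` K); first exact: has_cof_opp.
rewrite (eq_countable (_ : _ #= K)) //.
by apply: inj_card_eq => x y _ _; exact: oppr_inj.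
Qed.

End Reversal.

(** * Equivalence of the completeness conditions, and the extreme case *)

Theorem theorem9 (G : oagType) (hG : discretely_ordered G) :
  [<-> symmetrically_d_complete G;
       spherically_complete G;
       Zgroup G /\ strongly_symmetrically_complete (oquot (Zsub G))] /\
  (extremely_symmetrically_d_complete G <->
   extremely_symmetrically_complete (oquot (Zsub G))).
Proof.
have [e e_min] := hG.
have ac : symmetrically_d_complete G <->
    strongly_symmetrically_complete (oquot (Zsub G)).
  by split; [exact: sym_d_complete_quotient e_min|
             exact: quotient_sym_d_complete e_min].
split; first tfae.
- exact: sym_d_complete_spherically_complete.
- move=> /spherically_complete_sym_d_complete/ac ssc; split=> //.
  (* The divisibility criterion is applied to [G/Z], where all cuts are asymmetric, and not to [G],
     where the cut just above 0 has cofinality (1,1). *)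
  apply: (Zgroup_of_divisible e_min); apply: cut_asymmetric_divisible.
  by move=> D E /ssc[].
- by move=> [_ /ac].
have cof := uncountable_cof_quotient e_min.
split=> [[/ac ssc /cof cofQ]|[/ac sdc _ /cof cofG]]; last by split.
by split=> //; exact: uncountable_coinitiality.
Qed.
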